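(* Let $q$ be an odd prime power and $G=\mathrm{PSL}(2,q^2)$ acting on the points of $\mathrm{PG}(1,q^2)$. Let $A$ and $B$ be sublines lying in different $G$-orbits. Then $L=\{g\in G: |g(A)\cap B|=2\}$ is a Cameron-Liebler set for $G$ with its action on the projective points.
   Context: A subline is the image under $\mathrm{PGL}(2,q^2)$ of $\mathrm{PG}(1,q)=\{[x,y]:x,y\in\mathbb{F}_q\text{ not both }0\}$; $\mathrm{PSL}(2,q^2)$ has two orbits on sublines. For points $a,b$, the star is $G_{a\to b}=\{g:g(a)=b\}$ with indicator vector $\mathbf{v}_{a,b}$; a Cameron-Liebler set is a subset of $G$ whose indicator vector is a linear combination of the $\mathbf{v}_{a,b}$. *)

(* Defs.v *)
From HB Require Import structures.
From mathcomp Require Import all_boot all_order all_fingroup all_algebra.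
From mathcomp Require Import all_solvable all_character.

Set Implicit Arguments.
Unset Strict Implicit.
Unset Printing Implicit Defensive.

Import GRing.Theory GroupScope.
Local Open Scope ring_scope.

Section ProjectiveLine.

Variable F : finFieldType.

Definition line (v : 'rV[F]_2) : {set 'rV[F]_2} := rowg v.

Definition PG1 : {set {set 'rV[F]_2}} :=
  [set line v | v : 'rV[F]_2 & v != 0].

Definition SL2 : {set {'GL_2[F]}} := [set g | \det (GLval g) == 1].

Fact SL2_group_set : group_set SL2.
Proof.
apply/group_setP; split=> [|g h]; rewrite !inE ?det1 //.
by move=> /eqP dg /eqP dh; rewrite detM dg dh mulr1.
Qed.
Canonical SL2_group := Group SL2_group_set.

Definition PGL2 : {set coset_of 'Z('GL_2[F])} := ('GL_2[F] / 'Z('GL_2[F]))%g.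
Definition PSL2 : {set coset_of 'Z(SL2)} := (SL2 / 'Z(SL2))%g.

(* MathComp actions are right actions: [g] maps the line spanned by the row
   vector [v] to the line spanned by [v *m g]. *)
Definition GL2_act := set_action ('MR (GLrepr F 1)).

(* The operation [%%] moves only the sets that are fixed by the centre; all the
   lines are, see [PGL2_actE] and [PSL2_actE] below. *)
Definition PGL2_act := (GL2_act %% 'Z('GL_2[F]))%act.
Definition PSL2_act := (GL2_act %% 'Z(SL2))%act.

Lemma GL2_actE (v : 'rV[F]_2) (g : {'GL_2[F]}) :
  GL2_act (line v) g = line (v *m GLval g).
Proof.
have actE w : ('MR (GLrepr F 1))%act w g = w *m GLval g.
  by apply: (mx_repr_actE (GLrepr F 1)); rewrite inE.
apply/setP=> u; rewrite mem_rowg /=; apply/imsetP/idP => [[w]|].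
  by rewrite mem_rowg => wv ->; rewrite actE submxMr.
case/sub_rVP=> c ->; exists (c *: v); first by rewrite mem_rowg scalemx_sub.
by rewrite actE scalemxAl.
Qed.

Lemma SL2_cent_line (z : {'GL_2[F]}) (v : 'rV[F]_2) :
  z \in 'C(SL2) -> line (v *m GLval z) = line v.
Proof.
move=> Cz; set M := GLval z.
pose transvection (i j : 'I_2) : 'M[F]_2 := 1%:M + delta_mx i j.
have dt i j : i != j -> \det (transvection i j) = 1.
  move=> nij; rewrite (expand_det_row _ 0) !big_ord_recl big_ord0 /cofactor !det_mx11 !mxE.
  case: i j nij => [[|[|//]] ?] [[|[|//]] ?] //= _;
    by rewrite !(addr0, add0r, mulr0, mul0r, mulr1, subr0).
have comM i j : i != j -> M *m delta_mx i j = delta_mx i j *m M.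
  move=> nij.
  have Ut : transvection i j \in unitmx by rewrite unitmxE dt ?unitr1.
  pose g : {'GL_2[F]} := Sub (transvection i j) Ut.
  have gS : g \in SL2 by rewrite inE; apply/eqP; apply: dt.
  have /(congr1 (@GLval 2 F)) := centP Cz g gS.
  rewrite (_ : GLval (z * g)%g = M *m transvection i j) //.
  rewrite (_ : GLval (g * z)%g = transvection i j *m M) //.
  by rewrite mulmxDr mulmxDl mulmx1 mul1mx => /addrI.
have [c Mc] : exists c, M = c%:M.
  exists (M 0 0); have /matrixP C01 := comM 0 1 isT.
  have /matrixP C10 := comM 1 0 isT.
  have := (C01 0 1, C01 0 0, C10 1 1).
  rewrite !mxE !big_ord_recl !big_ord0 !mxE /=.
  rewrite !(mulr0, mulr1, mul0r, mul1r, addr0, add0r) => -[[e1 e2] e3].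
  apply/matrixP=> i j; rewrite !mxE.
  case: i j => [[|[|//]] hi] [[|[|//]] hj]; rewrite /= ?mulr1n ?mulr0n.
  - by congr (M _ _); apply: val_inj.
  - by apply: etrans (esym e3); congr (M _ _); apply: val_inj.
  - by apply: etrans (esym e2); congr (M _ _); apply: val_inj.
  - by apply: etrans (esym e1); congr (M _ _); apply: val_inj.
have c0 : c != 0.
  apply: contraTneq (GL_unitmx z : M \in unitmx) => c0.
  by rewrite Mc c0 unitmxE det_scalar expr0n unitr0.
rewrite Mc mul_mx_scalar; apply: eq_rowg; exact: eqmx_scale.
Qed.

Lemma GL2_centre_fix (H : {set {'GL_2[F]}}) (v : 'rV[F]_2) :
  SL2 \subset H -> line v \in 'Fix_GL2_act([set: {'GL_2[F]}] :&: 'Z(H)).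
Proof.
move=> sSH; rewrite setTI; apply/afixP=> z /setIP[_ Cz].
by rewrite GL2_actE SL2_cent_line // (subsetP (centS sSH)).
Qed.

Lemma PGL2_actE (v : 'rV[F]_2) (g : {'GL_2[F]}) :
  PGL2_act (line v) (coset 'Z('GL_2[F]) g) = line (v *m GLval g).
Proof.
have nZg : g \in 'N('Z('GL_2[F])).
  by rewrite (subsetP (normal_norm (center_normal _))) ?inE.
have fixv := @GL2_centre_fix setT v (subsetT _).
by rewrite -GL2_actE; apply: (modactE (to := GL2_act)) nZg fixv; rewrite inE.
Qed.

Lemma PSL2_actE (v : 'rV[F]_2) (g : {'GL_2[F]}) :
  g \in SL2 -> PSL2_act (line v) (coset 'Z(SL2) g) = line (v *m GLval g).
Proof.
move=> Sg; have nZg : g \in 'N('Z(SL2)).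
  by rewrite (subsetP (normal_norm (center_normal _))).
have fixv := GL2_centre_fix v (subxx SL2).
by rewrite -GL2_actE; apply: (modactE (to := GL2_act)) nZg fixv; rewrite inE.
Qed.

End ProjectiveLine.

Section Sublines.

Variables (Fq F : finFieldType) (iota : {rmorphism Fq -> F}).

Definition base_subline : {set {set 'rV[F]_2}} :=
  [set line (map_mx iota w) | w : 'rV[Fq]_2 & w != 0].

Definition sublines : {set {set {set 'rV[F]_2}}} :=
  orbit (PGL2_act F)^* (PGL2 F) base_subline.

End Sublines.

Section CameronLiebler.

Variables (K : numFieldType) (gT : finGroupType) (rT : finType).
Variables (D : {set gT}) (to : action D rT) (G : {set gT}) (X : {set rT}).

Definition star (a b : rT) : {set gT} := [set g in G | to a g == b].

Definition indicator (S : {set gT}) : {ffun gT -> K^o} :=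
  [ffun g => (g \in S)%:R].

Definition Cameron_Liebler (S : {set gT}) : Prop :=
  S \subset G /\
  exists c : rT -> rT -> K,
    indicator S = \sum_(a in X) \sum_(b in X) c a b *: indicator (star a b).

End CameronLiebler.

(* Main.v *)
(** Two sublines that share a point and lie in different PSL-orbits meet in
    exactly two points.  Move the second one to PG(1,q) and the common point to
    infinity: the first one becomes the image of PG(1,q) under x |-> a x + b.
    If a lies outside F_q, then 1, a is a basis of F_{q^2} over F_q, and the
    coordinates of b in it give exactly one more common point.  If a lies in
    F_q, then the first subline is a translate of PG(1,q), and translations
    have determinant 1.  So |g(A) cap B| is 0 or 2 for every g in G, and the
    indicator vector of L is half the sum of the v_{a,b} over a in A, b in B. *)
Require Import Defs.
From mathcomp Require Import all_boot all_order all_fingroup all_algebra.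
From mathcomp Require Import all_solvable all_character.
From mathcomp Require Import ring.

Section SublineIntersection.

Import GRing.Theory.
Local Open Scope ring_scope.

Set Implicit Arguments.
Unset Strict Implicit.

(** * Row vectors, two-by-two matrices and the lines they span or move *)

Section Lines.

Variable F : finFieldType.
Implicit Types (u v : 'rV[F]_2) (M X : 'M[F]_2).

Lemma row2P (R : Type) (u v : 'rV[R]_2) :
  u 0 0 = v 0 0 -> u 0 1 = v 0 1 -> u = v.
Proof.
move=> e0 e1; apply/rowP=> -[[|[|//]] hj].
- by rewrite (_ : Ordinal hj = 0) //; apply: val_inj.
by rewrite (_ : Ordinal hj = 1) //; apply: val_inj.
Qed.

Lemma mulmx2E (R : pzSemiRingType) m n (A : 'M[R]_(m, 2))
    (M : 'M[R]_(2, n)) i j :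
  (A *m M) i j = A i 0 * M 0 j + A i 1 * M 1 j.
Proof.
rewrite mxE !big_ord_recl big_ord0 addr0.
by congr (_ + A _ _ * M _ _); apply: val_inj.
Qed.

Lemma mx2P (R : pzSemiRingType) (M N : 'M[R]_2) :
  M 0 0 = N 0 0 -> M 0 1 = N 0 1 -> M 1 0 = N 1 0 -> M 1 1 = N 1 1 -> M = N.
Proof.
move=> e00 e01 e10 e11; apply/row_matrixP=> -[[|[|//]] hi].
- rewrite (_ : Ordinal hi = 0); last exact: val_inj.
  by apply: row2P; rewrite !mxE.
rewrite (_ : Ordinal hi = 1); last exact: val_inj.
by apply: row2P; rewrite !mxE.
Qed.

Lemma det_mx2 (R : comPzRingType) (M : 'M[R]_2) :
  \det M = M 0 0 * M 1 1 - M 0 1 * M 1 0.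
Proof.
rewrite (expand_det_row _ 0) !big_ord_recl big_ord0 /cofactor !det_mx11 !mxE /=.
rewrite expr0 expr1 mul1r mulN1r mulrN addr0.
by congr (M _ _ * M _ _ - M _ _ * M _ _); apply: val_inj.
Qed.

Lemma mulmx_unit_neq0 v M : M \in unitmx -> (v *m M != 0) = (v != 0).
Proof.
move=> uM; congr (~~ _); apply/eqP/eqP=> [vM0|->]; last exact: mul0mx.
by rewrite -(mulmxK uM v) vM0 mul0mx.
Qed.

Lemma line_eqP u v :
  u != 0 -> reflect (exists2 c, c != 0 & u = c *: v) (line u == line v).
Proof.
move=> u0; apply: (iffP eqP) => [uv|[c c0 ->]]; last exact/eq_rowg/eqmx_scale.
have /sub_rVP[c uc] : (u <= v)%MS by rewrite -rowgS -/(line _) uv.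
by exists c => //; apply: contraNneq u0 => c0; rewrite uc c0 scale0r.
Qed.

Lemma line_scale c v : c != 0 -> line (c *: v) = line v.
Proof. by move=> c0; exact/eq_rowg/eqmx_scale. Qed.

(** Takes a bare matrix, so that changes of coordinates need not be packaged as elements of
    ['GL_2[F]]. *)
Definition lmul (X : 'M[F]_2) (L : {set 'rV[F]_2}) := [set u *m X | u in L].

Lemma lmul_line v X : lmul X (line v) = line (v *m X).
Proof.
apply/setP=> u; rewrite mem_rowg; apply/imsetP/idP=> [[w]|].
  by rewrite mem_rowg => wv ->; rewrite submxMr.
case/sub_rVP=> c ->; exists (c *: v); first by rewrite mem_rowg scalemx_sub.
by rewrite scalemxAl.
Qed.

Lemma lmul_inj X : X \in unitmx -> injective (lmul X).
Proof. by move=> uX; apply/imset_inj/(can_inj (mulmxK uX)). Qed.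

End Lines.

(** * Cameron-Liebler sets from two-valued intersection sizes *)

(** At g in [G], the stars with a in [A] and b in [B] that contain g are counted by |g(A) cap B|,
    which is 0 or [n]; dividing by [n] gives the indicator. *)
Lemma Cameron_Liebler_intersection (K : numFieldType) (gT : finGroupType)
    (rT : finType) (D : {set gT}) (to : action D rT) (G : {set gT})
    (X A B : {set rT}) (n : nat) :
  (0 < n)%N -> A \subset X -> B \subset X ->
  (forall g, g \in G ->
     #|setact to A g :&: B| = 0%N \/ #|setact to A g :&: B| = n) ->
  Cameron_Liebler K to G X [set g in G | #|setact to A g :&: B| == n].
Proof.
move=> n_gt0 sAX sBX cardI.
split; first by apply/subsetP=> g; rewrite inE => /andP[].
exists (fun a b => ((a \in A) && (b \in B))%:R / n%:R).
apply/ffunP=> g; rewrite ffunE sum_ffunE inE.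
have cardE : #|setact to A g :&: B| = (\sum_(a in A) (to a g \in B))%N.
  have -> : setact to A g :&: B = [set to a g | a in A & to a g \in B].
    apply/setP=> x; rewrite inE setactE; apply/andP/imsetP=> [[]|].
      case/imsetP=> a Aa -> agB.
      by exists a; rewrite // inE Aa.
    by case=> a; rewrite inE => /andP[Aa agB] ->; split=> //; apply: imset_f.
  rewrite card_imset; last exact: act_inj.
  by rewrite -sum1_card big_mkcond [RHS]big_mkcond; apply: eq_bigr => a _;
    rewrite !inE; case: (a \in A) => //=; case: (to a g \in B).
have sumE : \sum_(a in A) \sum_(b in B) n%:R^-1 * (g \in star to G a b)%:R
          = (g \in G)%:R * (#|setact to A g :&: B|%:R / n%:R) :> K.
  rewrite cardE natr_sum mulr_suml mulr_sumr; apply: eq_bigr => a _.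
  rewrite -mulr_sumr [LHS]mulrC mulrA; congr (_ / _).
  (* For fixed a, only b = g(a) contributes to the inner sum, and only if it lies in [B]; outside
     [G] all stars vanish. *)
  have [gG|gNG] := boolP (g \in G); last first.
    by rewrite mul0r big1 // => b _; rewrite inE (negPf gNG).
  rewrite mul1r; have [agB|agNB] := boolP (to a g \in B).
    rewrite (bigD1 _ agB) /= inE gG eqxx big1 ?addr0 // => b /andP[_ nab].
    by rewrite inE eq_sym (negPf nab) andbF.
  rewrite big1 // => b Bb; rewrite inE.
  case: eqP => [ab|_]; last by rewrite andbF.
  by rewrite ab Bb in agNB.
transitivity ((g \in G)%:R * (#|setact to A g :&: B|%:R / n%:R) : K).
  have [gG|_] := boolP (g \in G); last by rewrite mul0r.
  rewrite mul1r; case: (cardI g gG) => ->.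
    by rewrite mul0r eq_sym eqn0Ngt n_gt0.
  by rewrite eqxx divff // Num.Theory.pnatr_eq0 -lt0n.
rewrite -sumE big_mkcond [RHS]big_mkcond; apply: eq_bigr => a _.
rewrite sum_ffunE; have [Aa|_] := boolP (a \in A); last first.
  case: ifP => // _; apply/esym/big1=> b _.
  by rewrite !ffunE mul0r scale0r.
rewrite (subsetP sAX a Aa) big_mkcond [RHS]big_mkcond; apply: eq_bigr => b _.
rewrite !ffunE; have [Bb|_] := boolP (b \in B).
  by rewrite (subsetP sBX b Bb) mul1r.
by rewrite mul0r scale0r if_same.
Qed.

(** * Sublines as images of PG(1,q) under matrices *)

Variables (Fq F : finFieldType) (iota : {rmorphism Fq -> F}).
Implicit Types (M N X : 'M[F]_2).

Definition subline M : {set {set 'rV[F]_2}} :=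
  [set line (map_mx iota w *m M) | w : 'rV[Fq]_2 & w != 0].

Lemma sublineP M L :
  reflect (exists2 w : 'rV[Fq]_2, w != 0 & L = line (map_mx iota w *m M))
          (L \in subline M).
Proof.
by apply: (iffP imsetP) => -[w w0 ->]; exists w => //; rewrite ?inE in w0 *.
Qed.

Lemma subline_mulr M X : subline (M *m X) = lmul X @: subline M.
Proof.
rewrite /subline -imset_comp; apply: eq_imset => w /=.
by rewrite lmul_line mulmxA.
Qed.

(** An invertible [P] permutes the nonzero rows over F_q; a subline thus fixes its matrix at best up
    to such left factors. *)
Lemma subline_mull (P : 'M[Fq]_2) M :
  P \in unitmx -> subline (map_mx iota P *m M) = subline M.
Proof.
move=> uP; apply/setP=> L; apply/sublineP/sublineP=> -[w w0 ->].
  by exists (w *m P); rewrite ?mulmx_unit_neq0 // map_mxM mulmxA.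
exists (w *m invmx P); first by rewrite mulmx_unit_neq0 ?unitmx_inv.
by rewrite mulmxA -map_mxM mulmxKV.
Qed.

Lemma subline_scale c M : c != 0 -> subline (c *: M) = subline M.
Proof.
by move=> c0; apply: eq_imset => w /=; rewrite -scalemxAr line_scale.
Qed.

Lemma card_subline_mulr M N X : X \in unitmx ->
  #|subline (M *m X) :&: subline (N *m X)| = #|subline M :&: subline N|.
Proof.
move=> /lmul_inj injX; rewrite !subline_mulr -imsetI ?card_imset //.
by move=> x y _ _; apply: injX.
Qed.

Lemma map_row_neq0 (w : 'rV[Fq]_2) : (map_mx iota w != 0) = (w != 0).
Proof. by rewrite map_mx_eq0. Qed.

(** * Sublines through the point at infinity, over a quadratic extension *)

Hypothesis card_F : #|F| = (#|Fq| ^ 2)%N.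

(* The map (s, t) |-> s a - t is injective, hence onto by cardinality. *)
Lemma quadratic_basis (a b : F) :
  a \notin codom iota -> exists s t, b = iota s * a - iota t.
Proof.
move=> aFq; pose f (x : Fq * Fq) := iota x.1 * a - iota x.2.
have injf : injective f.
  move=> [s t] [s' t'] /= /eqP; rewrite /f /= -subr_eq0.
  rewrite opprD addrACA -mulrBl -opprD -!rmorphB /= subr_eq0 => /eqP e.
  have [es|ns] := eqVneq s s'.
    move: e; rewrite es subrr rmorph0 mul0r => /esym/eqP.
    by rewrite fmorph_eq0 subr_eq0 => /eqP->.
  case/negP: aFq; apply/codomP; exists ((t - t') / (s - s')).
  rewrite rmorphM /= -e fmorphV mulrAC divff ?mul1r //.
  by rewrite fmorph_eq0 subr_eq0.
have /codomP[[s t] ->] : b \in codom f.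
  by apply: inj_card_onto injf _ b; rewrite card_prod card_F mulnn.
by exists s, t.
Qed.

Definition row2 (R : Type) (x y : R) : 'rV[R]_2 :=
  \row_j (if j == 0 then x else y).

(** [M] fixes [1,0] and sends [x,1] to [(x + b) / a, 1], where a = [M 1 1 / M 0 0] and b =
    [M 1 0 / M 0 0]. If a is in F_q, splitting off the scaling leaves a translation. Otherwise b = s
    a - t, and [t,1] goes to [s,1], the only other common point. *)
Lemma subline_triangular M : M \in unitmx -> M 0 1 = 0 ->
  #|subline M :&: subline 1%:M| = 2%N \/
  exists2 S : 'M[F]_2, \det S = 1 & subline M = subline S.
Proof.
move=> uM M01; have : \det M != 0 by rewrite -unitfE -unitmxE.
rewrite det_mx2 M01 mul0r subr0 mulf_eq0 => /norP[M00 M11].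
have [/codomP[a aE]|nFq] := boolP (M 1 1 / M 0 0 \in codom iota).
  right.
  (* M = c D S with D defined over F_q, so M and S give the same subline. *)
  pose S : 'M[F]_2 := 1%:M + (M 1 0 / M 1 1) *: delta_mx 1 0.
  exists S.
    by rewrite det_mx2 !mxE /= !(mulr0, mul0r, addr0, subr0, mulr1).
  pose D : 'M[Fq]_2 := diag_mx (row2 1 a).
  have uD : D \in unitmx.
    rewrite unitmxE unitfE det_mx2 !mxE /= mulr1n mul1r mul0r subr0 mulr1n.
    by rewrite -(fmorph_eq0 iota) -aE mulf_neq0 ?invr_neq0.
  rewrite -(subline_mull S uD) -(subline_scale (map_mx iota D *m S) M00).
  congr subline; apply: mx2P; rewrite [in RHS]mxE mulmx2E !mxE /= ?M01.
  - by rewrite rmorph1 rmorph0; ring.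
  - by rewrite rmorph1 rmorph0; ring.
  - by rewrite rmorph0 !mulr1n -aE; field; rewrite M00 M11.
  by rewrite rmorph0 !mulr1n -aE; field; rewrite M11 M00.
left; have [s [t bE]] := quadratic_basis (M 1 0 / M 0 0) nFq.
(* Eliminating k gives an F_q-multiple of a lying in F_q, hence zero. *)
have key (w w' : 'rV[Fq]_2) k : w != 0 -> w' != 0 ->
    map_mx iota w *m M = k *: map_mx iota w' ->
  w 0 1 = 0 \/ w' 0 0 = s * w' 0 1.
  move=> w0 w'0 /matrixP e; move: (e 0 0) (e 0 1).
  rewrite !mulmx2E !mxE M01 mulr0 add0r => e0 e1.
  have [|w1] := eqVneq (w 0 1) 0; [by left | right].
  have aM : iota (w 0 1 * w' 0 0 - s * w 0 1 * w' 0 1) * (M 1 1 / M 0 0)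
          = iota (w' 0 1 * (w 0 0 - t * w 0 1)).
    have M10 : M 1 0 = iota s * M 1 1 - iota t * M 0 0.
      by rewrite -(divfK M00 (M 1 0)) bE; field.
    apply: (mulIf M00); rewrite mulrA divfK //.
    transitivity (iota (w' 0 1) * (k * iota (w' 0 0))
                  - iota (s * w 0 1 * w' 0 1) * M 1 1).
      by rewrite rmorphB /= mulrBl (rmorphM iota (w 0 1)) mulrAC e1; ring.
    by rewrite -e0 M10; ring.
  have [/eqP|x0] := eqVneq (w 0 1 * w' 0 0 - s * w 0 1 * w' 0 1) 0.
    rewrite -mulrA [s * _]mulrCA -mulrBr mulf_eq0 (negPf w1) subr_eq0.
    by move/eqP.
  case/negP: nFq; apply/codomP.
  exists (w' 0 1 * (w 0 0 - t * w 0 1) / (w 0 1 * w' 0 0 - s * w 0 1 * w' 0 1)).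
  by rewrite rmorphM /= -aM fmorphV mulrAC divff ?mul1r // fmorph_eq0.
(* The two common points: infinity and [s,1]. *)
pose L1 := line (row2 1 0 : 'rV[F]_2); pose L2 := line (row2 (iota s) 1).
have v0 (R : nzRingType) (x : R) : row2 x 1 != 0.
  by apply/eqP=> /matrixP/(_ 0 1)/eqP; rewrite !mxE oner_eq0.
have e0 (R : nzRingType) : row2 1 0 != 0 :> 'rV[R]_2.
  by apply/eqP=> /matrixP/(_ 0 0)/eqP; rewrite !mxE oner_eq0.
have nL : L1 != L2.
  apply/negP=> /(line_eqP _ (e0 _))[c c0] /matrixP/(_ 0 1)/eqP.
  by rewrite !mxE mulr1 eq_sym (negPf c0).
suff -> : subline M :&: subline 1%:M = [set L1; L2] by rewrite cards2 nL.
apply/setP=> L; rewrite !inE; apply/andP/orP.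
  case=> /sublineP[w w0 ->] /sublineP[w' w'0] /eqP; rewrite mulmx1.
  case/line_eqP=> [|k k0 wE].
    by rewrite mulmx_unit_neq0 // map_row_neq0.
  have [w1|w'E] := key w w' k w0 w'0 wE; [left | right].
    apply/(line_eqP _); first by rewrite mulmx_unit_neq0 // map_row_neq0.
    exists (iota (w 0 0) * M 0 0).
      rewrite mulf_neq0 // fmorph_eq0; apply: contraNneq w0 => w00.
      by apply/eqP/row2P; rewrite mxE.
    by apply: row2P; rewrite !mulmx2E !mxE w1 rmorph0 ?M01 /=; ring.
  rewrite wE line_scale //; apply/line_eqP; first by rewrite map_row_neq0.
  exists (iota (w' 0 1)).
    rewrite fmorph_eq0; apply: contraNneq w'0 => w'1.
    by apply/eqP/row2P; rewrite mxE // w'E w'1 mulr0.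
  by apply: row2P; rewrite !mxE /= ?mulr1 // w'E rmorphM mulrC.
case=> /eqP->; split; apply/sublineP.
- exists (row2 1 0); rewrite ?e0 //; apply/eqP; rewrite eq_sym; apply/line_eqP.
    by rewrite mulmx_unit_neq0 // map_row_neq0 ?e0 ?v0.
  exists (M 0 0) => //; apply: row2P; rewrite mulmx2E !mxE /= ?M01.
    by rewrite rmorph1 rmorph0; ring.
  by rewrite rmorph1 rmorph0; ring.
- exists (row2 1 0); rewrite ?e0 //; congr line; rewrite mulmx1.
  by apply: row2P; rewrite !mxE /= ?rmorph1 ?rmorph0.
(* By b = s a - t, [M] sends (t,1) to [M 1 1] times (s,1). *)
- exists (row2 t 1); rewrite ?v0 //; apply/eqP; rewrite eq_sym; apply/line_eqP.
    by rewrite mulmx_unit_neq0 // map_row_neq0 ?e0 ?v0.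
  exists (M 1 1) => //; apply: row2P; rewrite mulmx2E !mxE /= ?M01.
    have -> : M 1 0 = M 0 0 * (M 1 0 / M 0 0) by field.
    by rewrite bE rmorph1; field.
  by rewrite rmorph1; ring.
exists (row2 s 1); rewrite ?v0 //; congr line; rewrite mulmx1.
by apply: row2P; rewrite !mxE /= ?rmorph1.
Qed.

(** * Intersection of two arbitrary sublines *)

Lemma unitmx_row0 (w : 'rV[Fq]_2) : w != 0 ->
  exists2 P : 'M[Fq]_2, P \in unitmx & row 0 P = w.
Proof.
move=> w0; have e0 : (delta_mx 0 0 : 'rV[Fq]_2) != 0.
  by apply/eqP=> /matrixP/(_ 0 0)/eqP; rewrite !mxE oner_eq0.
have [f wE] : exists f : 'M_2, delta_mx 0 0 *m f = w.
  (* All rows of this matrix equal [w]; [complete_unitmx] then replaces it by an invertible one with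
     the same first row. *)
  exists (\matrix_(i, j) w 0 j); rewrite -rowE.
  by apply: row2P; rewrite !mxE.
have [|P uP PE] := @complete_unitmx _ _ _ (delta_mx 0 0 : 'rV[Fq]_2) f.
  by rewrite wE !rank_rV w0 e0.
by exists P; rewrite // rowE -PE wE.
Qed.

(** Given a common point, coordinates are changed so that [N] yields PG(1,q) and the point becomes
    [1,0]; the first matrix is then triangular. *)
Lemma card_sublineI M N : M \in unitmx -> N \in unitmx ->
  [\/ #|subline M :&: subline N| = 0%N, #|subline M :&: subline N| = 2%N
    | exists2 S : 'M[F]_2, \det S = 1 & subline N = subline (M *m S)].
Proof.
move=> uM uN.
have [/eqP I0|/set0Pn[L]] := boolP (subline M :&: subline N == set0).
  by constructor 1; rewrite I0 cards0.
case/setIP=> /sublineP[w w0 ->] /sublineP[w' w'0] /eqP.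
case/line_eqP=> [|c c0 wc]; first by rewrite mulmx_unit_neq0 // map_row_neq0.
have [P uP Pw] := unitmx_row0 w0.
have [P' uP' Pw'] := unitmx_row0 w'0.
(* [X] sends the subline of [N] to PG(1,q) and, [w'] being the first row of [P'], the common point
   to [1,0]. *)
pose X := invmx N *m invmx (map_mx iota P').
have uiP' : map_mx iota P' \in unitmx by rewrite map_unitmx.
have uX : X \in unitmx by rewrite unitmx_mul !unitmx_inv uN.
have NX : subline (N *m X) = subline 1%:M.
  by rewrite mulmxA mulmxV // mul1mx -(subline_mull _ uP') mulmxV.
have MX : subline (M *m X) = subline (map_mx iota P *m M *m X).
  by rewrite -mulmxA subline_mull.
have [||I2|[S dS MS]] := @subline_triangular (map_mx iota P *m M *m X).
- by rewrite !unitmx_mul map_unitmx uP uM -unitmx_mul.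
- have : row 0 (map_mx iota P *m M *m X) = c *: row 0 1%:M.
    rewrite !row_mul -map_row Pw wc -!scalemxAl mulmxA mulmxK //.
    by rewrite -Pw' map_row -row_mul mulmxV.
  by move/matrixP/(_ 0 1); rewrite !mxE mulr0.
- by constructor 2; rewrite -(card_subline_mulr _ _ uX) NX MX.
have uS : S \in unitmx by rewrite unitmxE dS unitr1.
(* Otherwise [!mulmxA] below would unfold [X]. *)
clearbody X.
(* Since [M *m X] and [S] give the same subline, [M *m X *m invmx S] gives PG(1,q), as does
   [N *m X]; [invmx X] leads back to [N]. *)
constructor 3; exists (X *m invmx S *m invmx X).
  rewrite !det_mulmx !det_inv dS invr1 mulr1.
  by rewrite mulrV // -unitmxE.
rewrite !mulmxA subline_mulr subline_mulr MX MS -!subline_mulr mulmxV //.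
by rewrite subline_mulr -NX -subline_mulr mulmxK.
Qed.

(** * From matrices back to the actions of PGL and PSL *)

Lemma PSL2_act_subline M (g : {'GL_2[F]}) : g \in SL2 F ->
  setact (PSL2_act F) (subline M) (coset 'Z(SL2 F) g) = subline (M *m GLval g).
Proof.
move=> Sg; rewrite setactE /subline -imset_comp; apply: eq_imset => w /=.
by rewrite PSL2_actE // mulmxA.
Qed.

Lemma sublinesP A : A \in sublines iota ->
  exists2 M : 'M[F]_2, M \in unitmx & A = subline M.
Proof.
case/orbitP=> h /morphimP[g _ _ ->] <-.
exists (GLval g); first exact: (GL_unitmx g).
rewrite /= setactE /base_subline /subline -imset_comp.
by apply: eq_imset => w; exact: PGL2_actE.
Qed.

Lemma sublines_sub_PG1 A : A \in sublines iota -> A \subset PG1 F.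
Proof.
case/sublinesP=> M uM ->; apply/subsetP=> L /sublineP[w w0 ->].
by apply: imset_f; rewrite inE mulmx_unit_neq0 ?map_row_neq0.
Qed.

(** The remaining case of [card_sublineI] would carry h(A) to [B] by a matrix of determinant 1,
    putting [A] and [B] in one PSL-orbit. *)
Lemma card_sublinesI A B (h : coset_of 'Z(SL2 F)) :
  A \in sublines iota -> B \in sublines iota -> h \in PSL2 F ->
  orbit (PSL2_act F)^* (PSL2 F) A != orbit (PSL2_act F)^* (PSL2 F) B ->
  #|setact (PSL2_act F) A h :&: B| = 0%N \/
  #|setact (PSL2_act F) A h :&: B| = 2%N.
Proof.
case/sublinesP=> M uM -> /sublinesP[N uN ->] Gh nAB.
have /morphimP[g _ Sg hE] := Gh; rewrite hE PSL2_act_subline //.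
have uMg : M *m GLval g \in unitmx
  by rewrite unitmx_mul uM; exact: (GL_unitmx g).
have [|| [S dS NS]] := card_sublineI uMg uN; [by left | by right |].
case/eqP: nAB; apply/esym/orbit_in_eqP; rewrite ?NS.
  exact/quotientS/subsetT.
have uS : S \in unitmx by rewrite unitmxE dS unitr1.
pose s : {'GL_2[F]} := Sub S uS.
have Ss : s \in SL2 F by rewrite inE; apply/eqP.
(* Actions are on the right, so [B] is the image of [A] under the class of [g * s]. *)
rewrite -mulmxA -[_ *m S]/(GLval (g * s)%g) -PSL2_act_subline ?groupM //.
by apply: mem_orbit; rewrite mem_quotient ?groupM.
Qed.

End SublineIntersection.

Theorem theorem9p6 (K : numFieldType) (q : nat) (Fq F : finFieldType)
    (iota : {rmorphism Fq -> F}) (A B : {set {set 'rV[F]_2}}) :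
  odd q -> #|Fq| = q -> #|F| = (q ^ 2)%N ->
  A \in sublines iota -> B \in sublines iota ->
  orbit (PSL2_act F)^* (PSL2 F) A != orbit (PSL2_act F)^* (PSL2 F) B ->
  Cameron_Liebler K (PSL2_act F) (PSL2 F) (PG1 F)
    [set g in PSL2 F | #|(PSL2_act F)^* A g :&: B| == 2].
Proof.
move=> _ card_Fq; rewrite -card_Fq => card_F sA sB nAB.
apply: Cameron_Liebler_intersection => //.
- exact: sublines_sub_PG1 sA.
- exact: sublines_sub_PG1 sB.
by move=> g Gg; apply: card_sublinesI card_F _ _ _ sA sB Gg nAB.
Qed.
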